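(* Let $R$ be a term rewriting system over a signature $\Sigma$ and let $T \subseteq \mathcal{T}(\Sigma,\emptyset)$ be a set of ground terms. Then $R$ is terminating on $T$ if and only if there exists a well-founded monotone partial $\Sigma$-algebra $(A,[\![\cdot]\!],\succ)$ such that $T$ is defined (i.e. $[\![t]\!]$ is defined for every $t\in T$) and $\succ$ is a partial model for $R$.
   Context: A TRS $R$ over $\Sigma$ is a set of rules $\ell\to r$ with $\ell,r\in\mathcal{T}(\Sigma,\mathcal{X})$, $\ell\notin\mathcal{X}$, $\mathrm{Var}(r)\subseteq\mathrm{Var}(\ell)$; $\to_R$ is the usual one-step rewrite relation (closed under substitutions and contexts). $R$ is terminating on a set $T$ of terms if no $t\in T$ admits an infinite sequence $t=t_1\to_R t_2\to_R\cdots$ (the $t_i$, $i\ge 2$, need not lie in $T$). A partial $\Sigma$-algebra $(A,[\![\cdot]\!])$ consists of a non-empty set $A$ and for each $n$-ary $f\in\Sigma$ a partial function $[\![f]\!]:A^n\rightharpoonup A$. For a total assignment $\alpha:\mathcal{X}\to A$, the (possibly undefined) interpretation of terms is $[\![x]\!]_\alpha=\alpha(x)$ and $[\![f(t_1,\dots,t_n)]\!]_\alpha=[\![f]\!]([\![t_1]\!]_\alpha,\dots,[\![t_n]\!]_\alpha)$, which is defined only if all $[\![t_i]\!]_\alpha$ are defined and the tuple lies in the domain of $[\![f]\!]$; for ground $t$ write $[\![t]\!]$. Given a binary relation $\succ$ on $A$, a partial function $f$ is closed w.r.t. $\succ$ if whenever $f(\dots,a,\dots)$ is defined and $a\succ b$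 then $f(\dots,b,\dots)$ (same other arguments, same position) is defined; it is monotone w.r.t. $\succ$ if whenever $f(\dots,a,\dots)$ and $f(\dots,b,\dots)$ are defined and $a\succ b$ then $f(\dots,a,\dots)\succ f(\dots,b,\dots)$ (for every argument position). A monotone partial $\Sigma$-algebra $(A,[\![\cdot]\!],\succ)$ is a partial $\Sigma$-algebra with a relation $\succ$ on $A$ such that every $[\![f]\!]$ is closed and monotone w.r.t. $\succ$; it is well-founded if $\succ$ is well-founded. $\succ$ is a partial model for $R$ if for every rule $\ell\to r\in R$ and every $\alpha:\mathrm{Var}(\ell)\to A$: if $[\![\ell]\!]_\alpha$ is defined then $[\![\ell]\!]_\alpha\succ[\![r]\!]_\alpha$ (in particular $[\![r]\!]_\alpha$ is defined). *)

(* Defs.v *)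
From mathcomp Require Import all_boot.

Set Implicit Arguments.
Unset Strict Implicit.
Unset Printing Implicit Defensive.

Record signature : Type := Signature { symbol :> Type; arity : symbol -> nat }.

(* T(S, X); ground terms are [term S void]. *)
Inductive term (S : signature) (X : Type) : Type :=
| Var of X
| App (f : S) of {ffun 'I_(arity f) -> term S X}.

Arguments Var {S X} x.
Arguments App {S X} f ts.

Definition upd (n : nat) (A : Type) (v : {ffun 'I_n -> A}) (i : 'I_n) (a : A) :
  {ffun 'I_n -> A} := [ffun j => if j == i then a else v j].

Section Terms.
Context {S : signature}.

Inductive occurs {X : Type} (x : X) : term S X -> Prop :=
| occurs_var : occurs x (Var x)
| occurs_app (f : S) (ts : {ffun 'I_(arity f) -> term S X}) (i : 'I_(arity f)) :
    occurs x (ts i) -> occurs x (App f ts).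

Fixpoint subst {X Y : Type} (s : X -> term S Y) (t : term S X) : term S Y :=
  match t with
  | Var x => s x
  | App f ts => App f [ffun i => subst s (ts i)]
  end.

Definition of_ground {X : Type} : term S void -> term S X :=
  subst (of_void (term S X)).

End Terms.

Record trs (S : signature) (X : Type) : Type := Trs {
  rule :> term S X -> term S X -> Prop;
  rule_lhs_nonvar : forall l r, rule l r -> forall x, l <> Var x;
  rule_vars : forall l r, rule l r -> forall x, occurs x r -> occurs x l
}.

Inductive rewrites {S : signature} {X : Type} (R : trs S X) :
  term S X -> term S X -> Prop :=
| rewrites_root (l r : term S X) (s : X -> term S X) :
    R l r -> rewrites R (subst s l) (subst s r)
| rewrites_arg (f : S) (ts : {ffun 'I_(arity f) -> term S X})
    (i : 'I_(arity f)) (u : term S X) :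
    rewrites R (ts i) u -> rewrites R (App f ts) (App f (upd ts i u)).

Definition terminating_on {S : signature} {X : Type} (R : trs S X)
    (T : term S X -> Prop) : Prop :=
  forall t, T t ->
    ~ exists u : nat -> term S X,
        u 0 = t /\ forall i, rewrites R (u i) (u i.+1).

(* [op f v = None] means that v lies outside the domain of f; the field
   [point] witnesses that the carrier is non-empty. *)
Record palgebra (S : signature) : Type := PAlgebra {
  carrier :> Type;
  point : carrier;
  op : forall f : S, {ffun 'I_(arity f) -> carrier} -> option carrier
}.

(* The default [point A] is never reached: it stands for the value of an
   undefined argument, which the test excludes. *)
Fixpoint interp {S : signature} (A : palgebra S) {X : Type} (alpha : X -> A)
    (t : term S X) : option A :=
  match t with
  | Var x => Some (alpha x)
  | App f ts =>
      if [forall i, isSome (interp alpha (ts i))]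
      then op [ffun i => odflt (point A) (interp alpha (ts i))]
      else None
  end.

Definition ground_interp {S : signature} (A : palgebra S) (t : term S void) :
  option A := interp (of_void A) t.

Section Monotone.
Context {A : Type} (gt : A -> A -> Prop).

Definition closed_pfun (n : nat) (f : {ffun 'I_n -> A} -> option A) : Prop :=
  forall v i a b,
    isSome (f (upd v i a)) -> gt a b -> isSome (f (upd v i b)).

Definition monotone_pfun (n : nat) (f : {ffun 'I_n -> A} -> option A) : Prop :=
  forall v i a b c d,
    f (upd v i a) = Some c -> f (upd v i b) = Some d -> gt a b -> gt c d.

End Monotone.

Record monotone_palgebra (S : signature) : Type := MonotonePAlgebra {
  palg :> palgebra S;
  gt : palg -> palg -> Prop;
  op_closed : forall f : S, closed_pfun gt (@op S palg f);
  op_monotone : forall f : S, monotone_pfun gt (@op S palg f)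
}.

(* Stdlib's [well_founded] expects the smaller element on the left. *)
Definition well_founded_palgebra {S : signature} (A : monotone_palgebra S) :
  Prop := well_founded (fun a b : A => gt b a).

Definition partial_model {S : signature} {X : Type} (A : monotone_palgebra S)
    (R : trs S X) : Prop :=
  forall l r, R l r -> forall (alpha : X -> A) (a : A),
    interp alpha l = Some a ->
    exists2 b : A, interp alpha r = Some b & gt a b.

(* Main.v *)
Require Import Defs.
From mathcomp Require Import all_boot.
From mathcomp Require Import boolp.

Set Implicit Arguments.
Unset Strict Implicit.
Unset Printing Implicit Defensive.

(** If an algebra as in the theorem exists, rewriting a term with a defined
    value yields a term with a defined, strictly smaller value, so that terms
    with a defined value are strongly normalizing.
    Conversely, let the symbols act on terms by term formation, an operation
    being defined only if the term it builds is strongly normalizing, and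
    compare strongly normalizing terms by rewriting.  This algebra needs a term
    to be non-empty; any element of [T] will do, and if [T] is empty, an algebra
    without defined operations suffices. *)

Lemma Acc_no_descentP (A : Type) (gt : A -> A -> Prop) (a : A) :
  Acc (fun x y => gt y x) a <->
  ~ exists u : nat -> A, u 0 = a /\ forall i, gt (u i) (u i.+1).
Proof.
split=> [|no_descent].
  elim=> {}a _ IH [u [u0 gt_u]].
  apply: (IH (u 1)); first by rewrite -u0.
  by exists (fun i => u i.+1).
apply: contra_notP no_descent => nacc_a.
pose nacc b := ~ Acc (fun x y => gt y x) b.
have succ (b : {b | nacc b}) : {c : {b | nacc b} | gt (sval b) (sval c)}.
  case: b => b nacc_b; apply: cid => /=; apply: contra_notP (nacc_b) => no_succ.
  constructor=> c gt_bc; apply: contra_notP no_succ => nacc_c.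
  by exists (exist _ c nacc_c).
have [u [u0 gt_u]] := dependent_choice succ (exist _ a nacc_a).
by exists (fun i => sval (u i)); rewrite u0.
Qed.

Section Upd.
Variables (n : nat) (A : Type).
Implicit Types (v : {ffun 'I_n -> A}) (i : 'I_n).

Lemma upd_same v i : upd v i (v i) = v.
Proof. by apply/ffunP => j; rewrite ffunE; case: eqP => // ->. Qed.

Lemma upd_at v i a : upd v i a i = a.
Proof. by rewrite ffunE eqxx. Qed.

Lemma upd_upd v i a b : upd (upd v i a) i b = upd v i b.
Proof. by apply/ffunP => j; rewrite !ffunE; case: eqP. Qed.

End Upd.

Section TermInduction.
Variables (S : signature) (X : Type) (P : term S X -> Prop).
Hypothesis PVar : forall x, P (Var x).
Hypothesis PApp : forall (f : S) (ts : {ffun 'I_(arity f) -> term S X}),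
  (forall i, P (ts i)) -> P (App f ts).

(* The generated [term_ind] has no induction hypothesis for the arguments,
   which are nested in a [{ffun _}]. *)
Fixpoint term_nested_ind (t : term S X) : P t :=
  match t with
  | Var x => PVar x
  | App f ts => PApp (fun i => term_nested_ind (ts i))
  end.

End TermInduction.

Section StrongNormalization.
Variables (S : signature) (X : Type) (R : trs S X).

Definition strongly_normalizing : term S X -> Prop :=
  Acc (fun u t => rewrites R t u).

Lemma terminating_onP (T : term S X -> Prop) :
  terminating_on R T <-> forall t, T t -> strongly_normalizing t.
Proof.
by split=> snT t Tt; apply/Acc_no_descentP; exact: snT.
Qed.

Lemma rewrites_upd (f : S) ts (i : 'I_(arity f)) t u :
  rewrites R t u ->
  rewrites R (App f (upd ts i t)) (App f (upd ts i u)).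
Proof.
by move=> tu; rewrite -(upd_upd ts i t u); apply: rewrites_arg; rewrite upd_at.
Qed.

Lemma strongly_normalizing_rewrites t u :
  strongly_normalizing t -> rewrites R t u -> strongly_normalizing u.
Proof. by case=> sn_succ /sn_succ. Qed.

Lemma strongly_normalizing_arg (f : S) ts (i : 'I_(arity f)) :
  strongly_normalizing (App f ts) -> strongly_normalizing (ts i).
Proof.
move t_def : (App f ts) => t sn_t.
elim: sn_t ts t_def => {}t _ IH ts t_def; constructor=> u ts_u.
rewrite -[u](upd_at ts i); apply: IH (erefl _).
by rewrite -t_def; apply: rewrites_arg.
Qed.

End StrongNormalization.

Section Interp.
Variables (S : signature) (A : palgebra S).

Lemma interp_AppP (X : Type) (alpha : X -> A) (f : S) ts a :
  interp alpha (App f ts) = Some a <->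
  exists2 v : {ffun 'I_(arity f) -> A},
    forall i, interp alpha (ts i) = Some (v i) & op v = Some a.
Proof.
rewrite /=; split=> [|[v tsv <-]].
  case: ifP => // /forallP def opa.
  exists [ffun i => odflt (point A) (interp alpha (ts i))] => // i.
  by rewrite ffunE; case: (interp alpha (ts i)) (def i).
rewrite ifT; last by apply/forallP => i; rewrite tsv.
by congr op; apply/ffunP => i; rewrite ffunE tsv.
Qed.

Section Substitution.
Variables (X Y : Type) (s : X -> term S Y) (alpha : Y -> A).

Lemma interp_subst (beta : X -> A) t :
  (forall x, occurs x t -> interp alpha (s x) = Some (beta x)) ->
  interp alpha (subst s t) = interp beta t.
Proof.
elim/term_nested_ind: t => [x|f ts IH] s_beta; first exact/s_beta/occurs_var.
have eq_args i : interp alpha (subst s (ts i)) = interp beta (ts i).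
  by apply: IH => x x_ts; apply/s_beta/occurs_app/x_ts.
rewrite /=; under eq_forallb do rewrite ffunE eq_args.
by case: ifP => // _; congr op; apply/ffunP => i; rewrite !ffunE eq_args.
Qed.

Lemma interp_subst_occurs t a x :
  interp alpha (subst s t) = Some a -> occurs x t ->
  isSome (interp alpha (s x)).
Proof.
move=> t_a x_t; elim: x_t a t_a => [a /= -> //|f ts i _ IH a].
by case/interp_AppP=> v /(_ i); rewrite ffunE => /IH.
Qed.

End Substitution.

Lemma interp_of_ground (X : Type) (alpha : X -> A) (t : term S void) :
  interp alpha (of_ground t) = ground_interp A t.
Proof. by apply: interp_subst; case. Qed.

End Interp.

Lemma op_decreasing (S : signature) (A : monotone_palgebra S) (f : S)
    (v : {ffun 'I_(arity f) -> A}) i a b :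
  op v = Some a -> gt (v i) b ->
  exists2 c, op (upd v i b) = Some c & gt a c.
Proof.
rewrite -[in op v](upd_same v i) => v_a gt_vb.
have := op_closed (v := v) (i := i) _ gt_vb; rewrite v_a => /(_ isT).
case vb_c : (op (upd v i b)) => [c|//] _.
by exists c; last exact: op_monotone v_a vb_c gt_vb.
Qed.

Section PartialModel.
Variables (S : signature) (X : Type) (R : trs S X) (A : monotone_palgebra S).
Hypothesis modelA : partial_model A R.
Implicit Types (alpha : X -> A) (t u : term S X).

Lemma partial_model_subst l r s alpha a :
  R l r -> interp alpha (subst s l) = Some a ->
  exists2 b, interp alpha (subst s r) = Some b & gt a b.
Proof.
move=> lr sl_a; pose beta x := odflt (point A) (interp alpha (s x)).
have beta_l x : occurs x l -> interp alpha (s x) = Some (beta x).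
  move=> /(interp_subst_occurs sl_a); rewrite /beta.
  by case: (interp alpha (s x)).
have beta_r x : occurs x r -> interp alpha (s x) = Some (beta x).
  by move=> /(rule_vars lr)/beta_l.
move: sl_a; rewrite (interp_subst beta_l) (interp_subst beta_r).
exact: modelA.
Qed.

Lemma partial_model_rewrites alpha t u a :
  rewrites R t u -> interp alpha t = Some a ->
  exists2 b, interp alpha u = Some b & gt a b.
Proof.
move=> tu; elim: tu a => {t u} [l r s lr a|f ts i u _ IH a].
  exact: partial_model_subst.
case/interp_AppP=> v ts_v v_a.
have [b u_b gt_vb] := IH _ (ts_v i).
have [c vb_c gt_ac] := op_decreasing v_a gt_vb.
exists c => //; apply/interp_AppP; exists (upd v i b) => // j.
by rewrite !ffunE; case: eqP.
Qed.

Lemma partial_model_strongly_normalizing alpha t :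
  well_founded_palgebra A -> isSome (interp alpha t) ->
  strongly_normalizing R t.
Proof.
move=> wfA; case t_a : (interp alpha t) => [a|//] _.
elim: (wfA a) t t_a => {}a _ IH t t_a; constructor=> u tu.
by have [b u_b gt_ab] := partial_model_rewrites tu t_a; apply: IH gt_ab u u_b.
Qed.

End PartialModel.

Section TermAlgebra.
Variables (S : signature) (X : Type) (R : trs S X) (t0 : term S X).

Notation SN := (strongly_normalizing R).

Definition sn_app (f : S) (ts : {ffun 'I_(arity f) -> term S X}) :
    option (term S X) :=
  if `[< SN (App f ts) >] then Some (App f ts) else None.

Lemma sn_appP (f : S) (ts : {ffun 'I_(arity f) -> term S X}) t :
  sn_app ts = Some t <-> SN (App f ts) /\ t = App f ts.
Proof.
rewrite /sn_app; case: asboolP => [sn_ts|nsn_ts]; last by split=> // -[].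
by split=> [[<-]|[_ ->]].
Qed.

Definition sn_rewrites (t u : term S X) : Prop := SN t /\ rewrites R t u.

Lemma sn_app_decreasing (f : S) ts (i : 'I_(arity f)) t u a :
  sn_app (upd ts i t) = Some a -> sn_rewrites t u ->
  exists2 b, sn_app (upd ts i u) = Some b & sn_rewrites a b.
Proof.
case/sn_appP=> sn_t -> [_ /(rewrites_upd ts i) tu].
have sn_u := strongly_normalizing_rewrites sn_t tu.
by exists (App f (upd ts i u)); [apply/sn_appP | split].
Qed.

Lemma sn_app_closed (f : S) : closed_pfun sn_rewrites (@sn_app f).
Proof.
move=> ts i t u; case ts_a : (sn_app _) => [a|//] _ tu.
by have [b ->] := sn_app_decreasing ts_a tu.
Qed.

Lemma sn_app_monotone (f : S) : monotone_pfun sn_rewrites (@sn_app f).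
Proof.
move=> ts i t u a b ts_a ts_b tu.
by have [c] := sn_app_decreasing ts_a tu; rewrite ts_b => -[->].
Qed.

Definition sn_algebra : monotone_palgebra S :=
  @MonotonePAlgebra S (PAlgebra t0 sn_app) sn_rewrites
    sn_app_closed sn_app_monotone.

Lemma well_founded_sn_algebra : well_founded_palgebra sn_algebra.
Proof.
move=> t; constructor=> u [sn_t /(strongly_normalizing_rewrites sn_t)].
by elim=> {}u _ IH; constructor=> v [_ /IH].
Qed.

Section Interpretation.
Variables (Y : Type) (s : Y -> sn_algebra).

Lemma interp_sn_algebra_Some t a : interp s t = Some a -> a = subst s t.
Proof.
elim/term_nested_ind: t a => [x a [<-]//|f ts IH a].
case/interp_AppP=> v ts_v /sn_appP[_ ->] /=; congr App.
by apply/ffunP => i; rewrite ffunE; apply/IH/ts_v.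
Qed.

Lemma interp_sn_algebra t : SN (subst s t) -> interp s t = Some (subst s t).
Proof.
elim/term_nested_ind: t => [//|f ts IH] sn_ts.
apply/interp_AppP; exists [ffun i => subst s (ts i)]; last exact/sn_appP.
move=> i; rewrite ffunE; apply: IH.
by have := strongly_normalizing_arg i sn_ts; rewrite ffunE.
Qed.

Lemma interp_sn_algebra_App_sn (f : S) ts t :
  interp s (App f ts) = Some t -> SN t.
Proof. by case/interp_AppP=> v _ /sn_appP[sn_v ->]. Qed.

End Interpretation.

Lemma partial_model_sn_algebra : partial_model sn_algebra R.
Proof.
move=> l r lr s t l_t.
have sn_t : SN t.
  case: l lr l_t => [x /rule_lhs_nonvar/(_ x)//|f ts _].
  exact: interp_sn_algebra_App_sn.
have tr : rewrites R t (subst s r).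
  by rewrite (interp_sn_algebra_Some l_t); apply: rewrites_root.
exists (subst s r) => //.
exact/interp_sn_algebra/(strongly_normalizing_rewrites sn_t).
Qed.

End TermAlgebra.

Section UndefinedAlgebra.
Variable S : signature.

Definition undefined_palgebra : palgebra S :=
  @PAlgebra S unit tt (fun _ _ => None).

Definition undefined_algebra : monotone_palgebra S :=
  @MonotonePAlgebra S undefined_palgebra (fun _ _ => False)
    (fun _ _ _ _ _ def _ => def) (fun _ _ _ _ _ _ _ _ _ gt_ab => gt_ab).

Lemma well_founded_undefined_algebra : well_founded_palgebra undefined_algebra.
Proof. by []. Qed.

Lemma partial_model_undefined_algebra (X : Type) (R : trs S X) :
  partial_model undefined_algebra R.
Proof.
move=> [x|f ts] r lr alpha a; first by have /(_ x) := rule_lhs_nonvar lr.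
by case/interp_AppP.
Qed.

End UndefinedAlgebra.

Theorem theorem3p5 (S : signature) (X : Type) (R : trs S X)
    (T : term S void -> Prop) :
  terminating_on R (fun t => exists2 u, T u & t = of_ground u) <->
  exists A : monotone_palgebra S,
    [/\ well_founded_palgebra A,
        (forall t, T t -> isSome (ground_interp A t)) &
        partial_model A R].
Proof.
split=> [/terminating_onP snT|[A [wfA defT modelA]]]; last first.
  apply/terminating_onP => _ [t Tt ->].
  pose alpha (_ : X) := point A.
  apply: (partial_model_strongly_normalizing modelA (alpha := alpha) wfA).
  by rewrite interp_of_ground; apply: defT.
have [[t0 Tt0]|T_empty] := pselect (exists t, T t); last first.
  exists (undefined_algebra S); split=> [|t Tt|].
  - exact: well_founded_undefined_algebra.
  - by case: T_empty; exists t.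
  - exact: partial_model_undefined_algebra.
exists (sn_algebra R (of_ground t0)); split=> [|t Tt|].
- exact: well_founded_sn_algebra.
- have sn_t : strongly_normalizing R (of_ground t) by apply: snT; exists t.
  by rewrite /ground_interp (interp_sn_algebra sn_t).
- exact: partial_model_sn_algebra.
Qed.
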